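(* Let $(B^*,B)$ be a decorated bicategory and let $\Phi$ be a $\pi_2$-opindexing or a $\pi_2$-indexing on $(B^*,B)$. If $C$ is a double category inducing $\Phi$, then $\ell C=1$.
   Context: **Double categories.** A double category $C$ has a category of objects and vertical morphisms $C_0$, a category of horizontal morphisms and squares $C_1$ (composition in $C_1$ is vertical composition of squares), left and right frame functors $L,R:C_1\to C_0$, a unit functor $U:C_0\to C_1$, and horizontal composition. Vertical composition is strict; horizontal composition may be associative and unital only up to coherent globular isomorphism. For squares, $\psi\circ\varphi$ denotes the vertical composite with $\varphi$ on top and $\psi$ below. $U_a$ is the horizontal identity of an object $a$ and $U_f$ is the horizontal identity (unit) square of a vertical morphism $f$. A square is globular if its left and right frames are vertical identities. Objects, horizontal morphisms and globular squares of $C$ form a bicategory $HC$. $\pi_2(C,a)$ is the set of globular squares $U_a\Rightarrow U_a$; by Eckmann–Hilton it is a commutative monoid. For a bicategory $B$, $\pi_2(B,a)$ is the commutative monoid of 2-cells $\mathrm{id}_a\Rightarrow \mathrm{id}_a$. **Decorated bicategories and internalizations.** A decorated bicategory $(B^*,B)$ is a bicategory $B$ together with a category $B^*$ having the same objects as $B$. An internalization of $(B^*,B)$ is a double category $C$ with $(C_0,HC)=(B^*,B)$. **$\pi_2$-indexings and $\pi_2$-opindexings.** A $\pi_2$-indexing on $(B^*,B)$ is a functor $\Phi:B^*\to\mathbf{commMon}$ to the category of commutative monoids with $\Phi(a)=\pi_2(B,a)$ for every object $a$. A $\pi_2$-opindexing is a functor $\Phi:(B^* )^{op}\to\mathbf{commMon}$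 with $\Phi(a)=\pi_2(B,a)$ for every object $a$. Write $\Phi_f=\Phi(f)$. **Inducing.** A double category $C$ inducing $\Phi$ is an internalization of $(B^*,B)$ such that: if $\Phi$ is a $\pi_2$-opindexing, for every vertical $f:a\to b$ and every $\varphi\in\pi_2(C,b)$ one has $\varphi\circ U_f=U_f\circ\Phi_f(\varphi)$; if $\Phi$ is a $\pi_2$-indexing, for every vertical $f:a\to b$ and every $\varphi\in\pi_2(C,a)$ one has $U_f\circ\varphi=\Phi_f(\varphi)\circ U_f$. **Length 1.** $\gamma C$ (the globularly generated piece of $C$) is the sub-double category of $C$ generated by the globular squares and the unit squares $U_f$ of $C$ (all squares obtained from these by vertical and horizontal composition). $\ell C=1$ means that every square of $\gamma C$ can be written as a vertical composite of finitely many squares, each of which is globular or a unit square $U_f$. *)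

(* Defs.v *)
From HB Require Import structures.
From mathcomp Require Import ssreflect ssrfun ssrbool bigop.
From Stdlib Require Import ProofIrrelevance.

Set Implicit Arguments.
Unset Strict Implicit.
Unset Printing Implicit Defensive.

Declare Scope cat_scope.
Delimit Scope cat_scope with cat.
Local Open Scope cat_scope.

(* The class of objects is a parameter, so that "two categories with the same
   objects" and "a functor with prescribed values on objects" can be stated
   without comparing types or transporting along equalities. *)
Record cat_on (Ob : Type) := Cat {
  hom : Ob -> Ob -> Type;
  idm : forall x, hom x x;
  mcomp : forall x y z, hom y z -> hom x y -> hom x z;
  mcomp1m : forall x y (f : hom x y), mcomp (idm y) f = f;
  mcompm1 : forall x y (f : hom x y), mcomp f (idm x) = f;
  mcompA : forall x y z t (h : hom z t) (g : hom y z) (f : hom x y),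
    mcomp h (mcomp g f) = mcomp (mcomp h g) f }.

Arguments hom {Ob} C x y : rename.
Arguments idm {Ob C} x : rename.
Arguments mcomp {Ob C x y z} g f : rename.
Notation "g ∘ f" := (mcomp g f) (at level 40, left associativity) : cat_scope.

Record iso Ob (C : cat_on Ob) (x y : Ob) := Iso {
  isom :> hom C x y;
  isoV : hom C y x;
  isoVm : isoV ∘ isom = idm x;
  isomV : isom ∘ isoV = idm y }.

Definition op_cat Ob (C : cat_on Ob) : cat_on Ob :=
  @Cat Ob (fun x y => hom C y x) (fun x => idm x) (fun x y z g f => f ∘ g)
    (fun x y f => mcompm1 f) (fun x y f => mcomp1m f)
    (fun x y z t h g f => esym (mcompA f g h)).

Record functor_on Ob1 (C1 : cat_on Ob1) Ob2 (C2 : cat_on Ob2)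
    (F0 : Ob1 -> Ob2) := Functor {
  fmap : forall x y, hom C1 x y -> hom C2 (F0 x) (F0 y);
  fmap1 : forall x, fmap (idm x) = idm (F0 x);
  fmapM : forall x y z (g : hom C1 y z) (f : hom C1 x y),
    fmap (g ∘ f) = fmap g ∘ fmap f }.

Arguments fmap {Ob1 C1 Ob2 C2 F0} F {x y} f : rename.

(* [nmodType] would require a choice operator on the carrier. *)
Record commMon := CommMon {
  cm_sort :> Type;
  cm_one : cm_sort;
  cm_mul : Monoid.com_law cm_one }.

Record cm_hom (M N : commMon) := CmHom {
  cm_fun :> M -> N;
  cm_fun1 : cm_fun (cm_one M) = cm_one N;
  cm_funM : {morph cm_fun : x y / cm_mul M x y >-> cm_mul N x y} }.

Lemma cm_hom_eq M N (f g : cm_hom M N) : cm_fun f = cm_fun g -> f = g.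
Proof.
case: f => f f1 fM; case: g => g g1 gM /= e; subst g.
by rewrite (proof_irrelevance _ f1 g1) (proof_irrelevance _ fM gM).
Qed.

Definition cm_id M : cm_hom M M := @CmHom M M id erefl (fun _ _ => erefl).

Definition cm_comp M N P (g : cm_hom N P) (f : cm_hom M N) : cm_hom M P.
Proof.
exists (g \o f); first by rewrite /= !cm_fun1.
by move=> x y; rewrite /= !cm_funM.
Defined.

Definition commMon_cat : cat_on commMon.
Proof.
by exists cm_hom cm_id cm_comp => *; apply: cm_hom_eq.
Defined.

(* Horizontal composites are written in diagrammatic order: [h ⊙ k] is [h]
   followed by [k], matching the left-to-right juxtaposition of squares. *)
Record bicat_on (Ob : Type) := Bicat {
  arr : Ob -> Ob -> Type;
  cells : forall a b, cat_on (arr a b);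
  arr1 : forall a, arr a a;
  arr_comp : forall a b c, arr a b -> arr b c -> arr a c;
  cell_comp : forall a b c (h h' : arr a b) (k k' : arr b c),
    hom (cells a b) h h' -> hom (cells b c) k k' ->
    hom (cells a c) (arr_comp h k) (arr_comp h' k');
  cell_comp1 : forall a b c (h : arr a b) (k : arr b c),
    cell_comp (idm h) (idm k) = idm (arr_comp h k);
  cell_compM : forall a b c (h h' h'' : arr a b) (k k' k'' : arr b c)
      (s' : hom (cells a b) h' h'') (s : hom (cells a b) h h')
      (t' : hom (cells b c) k' k'') (t : hom (cells b c) k k'),
    cell_comp (s' ∘ s) (t' ∘ t) = cell_comp s' t' ∘ cell_comp s t;
  bassoc : forall a b c d (h : arr a b) (k : arr b c) (l : arr c d),
    iso (cells a d) (arr_comp (arr_comp h k) l) (arr_comp h (arr_comp k l));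
  blunit : forall a b (h : arr a b), iso (cells a b) (arr_comp (arr1 a) h) h;
  brunit : forall a b (h : arr a b), iso (cells a b) (arr_comp h (arr1 b)) h;
  bassoc_nat : forall a b c d (h h' : arr a b) (k k' : arr b c) (l l' : arr c d)
      (s : hom (cells a b) h h') (t : hom (cells b c) k k')
      (u : hom (cells c d) l l'),
    bassoc h' k' l' ∘ cell_comp (cell_comp s t) u
    = cell_comp s (cell_comp t u) ∘ bassoc h k l;
  blunit_nat : forall a b (h h' : arr a b) (s : hom (cells a b) h h'),
    blunit h' ∘ cell_comp (idm (arr1 a)) s = s ∘ blunit h;
  brunit_nat : forall a b (h h' : arr a b) (s : hom (cells a b) h h'),
    brunit h' ∘ cell_comp s (idm (arr1 b)) = s ∘ brunit h;
  bpentagon : forall a b c d e (h : arr a b) (k : arr b c) (l : arr c d)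
      (m : arr d e),
    cell_comp (idm h) (bassoc k l m) ∘ bassoc h (arr_comp k l) m
      ∘ cell_comp (bassoc h k l) (idm m)
    = bassoc h k (arr_comp l m) ∘ bassoc (arr_comp h k) l m;
  btriangle : forall a b c (h : arr a b) (k : arr b c),
    cell_comp (idm h) (blunit k) ∘ bassoc h (arr1 b) k
    = cell_comp (brunit h) (idm k) }.

Arguments arr {Ob} B a b : rename.
Arguments cells {Ob} B a b : rename.
Arguments arr1 {Ob} B a : rename.
Arguments arr_comp {Ob B a b c} h k : rename.
Arguments cell_comp {Ob B a b c h h' k k'} s t : rename.
Arguments blunit {Ob B a b} h : rename.
Arguments brunit {Ob B a b} h : rename.

Section Pi2.
Variables (Ob : Type) (B : bicat_on Ob) (a : Ob).

Definition pi2_sort : Type := hom (cells B a a) (arr1 B a) (arr1 B a).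
Definition pi2_one : pi2_sort := idm (arr1 B a).
Definition pi2_mul (s t : pi2_sort) : pi2_sort := s ∘ t.

Lemma pi2_mulA : associative pi2_mul.
Proof. by move=> s t u; apply: mcompA. Qed.

Lemma pi2_mul1 : left_id pi2_one pi2_mul.
Proof. by move=> s; apply: mcomp1m. Qed.

Lemma pi2_mulC : commutative pi2_mul.
Proof.
rewrite /pi2_mul => s t.
set l := blunit (arr1 B a); set r := brunit (arr1 B a).
pose o : pi2_sort := idm (arr1 B a).
have slide (u v : pi2_sort) :
    cell_comp u o ∘ cell_comp o v = cell_comp o v ∘ cell_comp u o.
  by rewrite -!cell_compM !mcomp1m !mcompm1.
have El (u : pi2_sort) : cell_comp o u = isoV l ∘ (u ∘ l).
  by rewrite -(blunit_nat u) mcompA isoVm mcomp1m.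
have Er (u : pi2_sort) : cell_comp u o = isoV r ∘ (u ∘ r).
  by rewrite -(brunit_nat u) mcompA isoVm mcomp1m.
pose w : pi2_sort := l ∘ isoV r; pose w' : pi2_sort := r ∘ isoV l.
have w'w : w' ∘ w = o.
  by rewrite /w /w' -mcompA (mcompA (isoV l)) isoVm mcomp1m isomV.
have key (v : pi2_sort) : s ∘ (w' ∘ (v ∘ w)) = (w' ∘ (v ∘ w)) ∘ s.
  have := slide s v; rewrite El Er => /(congr1 (fun z => r ∘ z ∘ isoV r)).
  rewrite /w /w' !mcompA isomV mcomp1m -!mcompA isomV mcompm1 => ->.
  by rewrite !mcompA.
move: (w) (w') w'w key => {}w {}w' w'w key.
have E : w' ∘ ((w ∘ (t ∘ w')) ∘ w) = t.
  by rewrite -!mcompA w'w mcompm1 mcompA w'w mcomp1m.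
by have := key (w ∘ (t ∘ w')); rewrite E.
Qed.

HB.instance Definition _ :=
  Monoid.isComLaw.Build pi2_sort pi2_one pi2_mul pi2_mulA pi2_mulC pi2_mul1.

Definition pi2 : commMon := @CommMon pi2_sort pi2_one pi2_mul.

End Pi2.

Record decorated_bicat := Decorated {
  dob : Type;
  deco : cat_on dob;
  dbicat : bicat_on dob }.

Definition pi2_indexing (D : decorated_bicat) :=
  functor_on (deco D) commMon_cat (pi2 (dbicat D)).

Definition pi2_opindexing (D : decorated_bicat) :=
  functor_on (op_cat (deco D)) commMon_cat (pi2 (dbicat D)).

Record harrow (Ob : Type) (H : Ob -> Ob -> Type) := Harrow {
  hsrc : Ob;
  htgt : Ob;
  harr : H hsrc htgt }.

Arguments Harrow {Ob H hsrc htgt} harr.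

(* [vcat] is C_0 and [sqcat] is C_1, whose composition is the vertical
   composition of squares.  The functors [Lfun], [Rfun] and [Ufun] have
   prescribed values on objects, so [L U = R U = id] holds definitionally on
   objects.  Horizontal composition [hcomp2] is a functor on the pullback
   C_1 x_{C_0} C_1: it takes a proof that the frames of the squares match.
   Equations between horizontal composites are required for all such proofs. *)
Record double_cat := DoubleCat {
  cob : Type;
  vcat : cat_on cob;
  hmor : cob -> cob -> Type;
  sqcat : cat_on (harrow hmor);
  Lfun : functor_on sqcat vcat (@hsrc cob hmor);
  Rfun : functor_on sqcat vcat (@htgt cob hmor);
  hunit : forall a, hmor a a;
  Ufun : functor_on vcat sqcat (fun a => Harrow (hunit a));
  lframe_unit : forall a b (f : hom vcat a b), fmap Lfun (fmap Ufun f) = f;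
  rframe_unit : forall a b (f : hom vcat a b), fmap Rfun (fmap Ufun f) = f;
  hcomp : forall a b c, hmor a b -> hmor b c -> hmor a c;
  hcomp2 : forall a b c a' b' c' (h : hmor a b) (k : hmor b c)
      (h' : hmor a' b') (k' : hmor b' c')
      (s : hom sqcat (Harrow h) (Harrow h'))
      (t : hom sqcat (Harrow k) (Harrow k')),
    fmap Rfun s = fmap Lfun t ->
    hom sqcat (Harrow (hcomp h k)) (Harrow (hcomp h' k'));
  lframe_comp : forall a b c a' b' c' (h : hmor a b) (k : hmor b c)
      (h' : hmor a' b') (k' : hmor b' c')
      (s : hom sqcat (Harrow h) (Harrow h'))
      (t : hom sqcat (Harrow k) (Harrow k')) (e : fmap Rfun s = fmap Lfun t),
    fmap Lfun (hcomp2 e) = fmap Lfun s;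
  rframe_comp : forall a b c a' b' c' (h : hmor a b) (k : hmor b c)
      (h' : hmor a' b') (k' : hmor b' c')
      (s : hom sqcat (Harrow h) (Harrow h'))
      (t : hom sqcat (Harrow k) (Harrow k')) (e : fmap Rfun s = fmap Lfun t),
    fmap Rfun (hcomp2 e) = fmap Rfun t;
  hcomp21 : forall a b c (h : hmor a b) (k : hmor b c)
      (e : fmap Rfun (idm (Harrow h)) = fmap Lfun (idm (Harrow k))),
    hcomp2 e = idm (Harrow (hcomp h k));
  hcomp2M : forall a b c a' b' c' a'' b'' c''
      (h : hmor a b) (k : hmor b c) (h' : hmor a' b') (k' : hmor b' c')
      (h'' : hmor a'' b'') (k'' : hmor b'' c'')
      (s' : hom sqcat (Harrow h') (Harrow h''))
      (s : hom sqcat (Harrow h) (Harrow h'))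
      (t' : hom sqcat (Harrow k') (Harrow k''))
      (t : hom sqcat (Harrow k) (Harrow k'))
      (e' : fmap Rfun s' = fmap Lfun t') (e : fmap Rfun s = fmap Lfun t)
      (e'' : fmap Rfun (s' ∘ s) = fmap Lfun (t' ∘ t)),
    hcomp2 e'' = hcomp2 e' ∘ hcomp2 e;
  hassoc : forall a b c d (h : hmor a b) (k : hmor b c) (l : hmor c d),
    iso sqcat (Harrow (hcomp (hcomp h k) l)) (Harrow (hcomp h (hcomp k l)));
  lframe_assoc : forall a b c d (h : hmor a b) (k : hmor b c) (l : hmor c d),
    fmap Lfun (hassoc h k l) = idm a;
  rframe_assoc : forall a b c d (h : hmor a b) (k : hmor b c) (l : hmor c d),
    fmap Rfun (hassoc h k l) = idm d;
  hlunit : forall a b (h : hmor a b),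
    iso sqcat (Harrow (hcomp (hunit a) h)) (Harrow h);
  lframe_lunit : forall a b (h : hmor a b), fmap Lfun (hlunit h) = idm a;
  rframe_lunit : forall a b (h : hmor a b), fmap Rfun (hlunit h) = idm b;
  hrunit : forall a b (h : hmor a b),
    iso sqcat (Harrow (hcomp h (hunit b))) (Harrow h);
  lframe_runit : forall a b (h : hmor a b), fmap Lfun (hrunit h) = idm a;
  rframe_runit : forall a b (h : hmor a b), fmap Rfun (hrunit h) = idm b;
  hassoc_nat : forall a b c d a' b' c' d'
      (h : hmor a b) (k : hmor b c) (l : hmor c d)
      (h' : hmor a' b') (k' : hmor b' c') (l' : hmor c' d')
      (s : hom sqcat (Harrow h) (Harrow h'))
      (t : hom sqcat (Harrow k) (Harrow k'))
      (u : hom sqcat (Harrow l) (Harrow l'))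
      (st : fmap Rfun s = fmap Lfun t) (tu : fmap Rfun t = fmap Lfun u)
      (st_u : fmap Rfun (hcomp2 st) = fmap Lfun u)
      (s_tu : fmap Rfun s = fmap Lfun (hcomp2 tu)),
    hassoc h' k' l' ∘ hcomp2 st_u = hcomp2 s_tu ∘ hassoc h k l;
  hlunit_nat : forall a b a' b' (h : hmor a b) (h' : hmor a' b')
      (s : hom sqcat (Harrow h) (Harrow h'))
      (e : fmap Rfun (fmap Ufun (fmap Lfun s)) = fmap Lfun s),
    hlunit h' ∘ hcomp2 e = s ∘ hlunit h;
  hrunit_nat : forall a b a' b' (h : hmor a b) (h' : hmor a' b')
      (s : hom sqcat (Harrow h) (Harrow h'))
      (e : fmap Rfun s = fmap Lfun (fmap Ufun (fmap Rfun s))),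
    hrunit h' ∘ hcomp2 e = s ∘ hrunit h;
  hpentagon : forall a b c d e (h : hmor a b) (k : hmor b c) (l : hmor c d)
      (m : hmor d e)
      (e1 : fmap Rfun (idm (Harrow h)) = fmap Lfun (hassoc k l m))
      (e2 : fmap Rfun (hassoc h k l) = fmap Lfun (idm (Harrow m))),
    hcomp2 e1 ∘ hassoc h (hcomp k l) m ∘ hcomp2 e2
    = hassoc h k (hcomp l m) ∘ hassoc (hcomp h k) l m;
  htriangle : forall a b c (h : hmor a b) (k : hmor b c)
      (e1 : fmap Rfun (idm (Harrow h)) = fmap Lfun (hlunit k))
      (e2 : fmap Rfun (hrunit h) = fmap Lfun (idm (Harrow k))),
    hcomp2 e1 ∘ hassoc h (hunit b) k = hcomp2 e2 }.

Arguments hmor C a b : clear implicits, rename.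
Arguments hunit {C} a : rename.
Arguments hcomp {C a b c} h k : rename.
Arguments hcomp2 {C a b c a' b' c' h k h' k' s t} e : rename.

Notation lframe s := (fmap (Lfun _) s).
Notation rframe s := (fmap (Rfun _) s).
Notation hunit2 f := (fmap (Ufun _) f).
Notation square C h k := (hom (sqcat C) (Harrow h) (Harrow k)).

Record globular (C : double_cat) (a b : cob C) (h k : hmor C a b) := Globular {
  gsq :> square C h k;
  lframe_gsq : lframe gsq = idm a;
  rframe_gsq : rframe gsq = idm b }.

Section Horizontal.
Variable C : double_cat.

Lemma globular_eq (a b : cob C) (h k : hmor C a b) (s t : globular h k) :
  gsq s = gsq t -> s = t.
Proof.
case: s => s sl sr; case: t => t tl tr /= e; subst t.
by rewrite (proof_irrelevance _ sl tl) (proof_irrelevance _ sr tr).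
Qed.

Definition glob_id (a b : cob C) (h : hmor C a b) : globular h h :=
  @Globular C a b h h (idm (Harrow h)) (fmap1 _ _) (fmap1 _ _).

Lemma lframe_vcomp (a b : cob C) (h k l : hmor C a b)
  (t : globular k l) (s : globular h k) : lframe (t ∘ s) = idm a.
Proof. by rewrite fmapM !lframe_gsq; apply: mcomp1m. Qed.

Lemma rframe_vcomp (a b : cob C) (h k l : hmor C a b)
  (t : globular k l) (s : globular h k) : rframe (t ∘ s) = idm b.
Proof. by rewrite fmapM !rframe_gsq; apply: mcomp1m. Qed.

Definition glob_vcomp (a b : cob C) (h k l : hmor C a b)
  (t : globular k l) (s : globular h k) : globular h l :=
  Globular (lframe_vcomp t s) (rframe_vcomp t s).

Lemma glob_comp1m (a b : cob C) (h k : hmor C a b) (s : globular h k) :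
  glob_vcomp (glob_id k) s = s.
Proof. by apply: globular_eq; apply: mcomp1m. Qed.

Lemma glob_compm1 (a b : cob C) (h k : hmor C a b) (s : globular h k) :
  glob_vcomp s (glob_id h) = s.
Proof. by apply: globular_eq; apply: mcompm1. Qed.

Lemma glob_compA (a b : cob C) (h k l m : hmor C a b)
  (u : globular l m) (t : globular k l) (s : globular h k) :
  glob_vcomp u (glob_vcomp t s) = glob_vcomp (glob_vcomp u t) s.
Proof. by apply: globular_eq; apply: mcompA. Qed.

Definition glob_cat (a b : cob C) : cat_on (hmor C a b) :=
  @Cat (hmor C a b) (@globular C a b) (@glob_id a b) (@glob_vcomp a b)
    (@glob_comp1m a b) (@glob_compm1 a b) (@glob_compA a b).

Lemma glob_frames (a b c : cob C) (h h' : hmor C a b) (k k' : hmor C b c)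
  (s : globular h h') (t : globular k k') : rframe s = lframe t.
Proof. by rewrite rframe_gsq lframe_gsq. Qed.

Definition glob_hcomp (a b c : cob C) (h h' : hmor C a b) (k k' : hmor C b c)
  (s : globular h h') (t : globular k k') :
  globular (hcomp h k) (hcomp h' k') :=
  Globular (etrans (lframe_comp (glob_frames s t)) (lframe_gsq s))
           (etrans (rframe_comp (glob_frames s t)) (rframe_gsq t)).

Section GlobularIso.
Variables (a b : cob C) (h k : hmor C a b).
Variable s : iso (sqcat C) (Harrow h) (Harrow k).
Hypotheses (sl : lframe s = idm a) (sr : rframe s = idm b).

Lemma lframe_isoV : lframe (isoV s) = idm a.
Proof.
have := congr1 (fun t => fmap (Lfun C) t) (isoVm s).
by rewrite fmapM sl (mcompm1 (lframe (isoV s))) fmap1.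
Qed.

Lemma rframe_isoV : rframe (isoV s) = idm b.
Proof.
have := congr1 (fun t => fmap (Rfun C) t) (isoVm s).
by rewrite fmapM sr (mcompm1 (rframe (isoV s))) fmap1.
Qed.

Definition glob_iso : iso (glob_cat a b) h k.
Proof.
by exists (Globular sl sr) (Globular lframe_isoV rframe_isoV);
  apply: globular_eq; [apply: isoVm | apply: isomV].
Defined.

End GlobularIso.

Lemma glob_lunit_nat (a b : cob C) (h h' : hmor C a b) (s : globular h h')
    (e : rframe (idm (Harrow (hunit a))) = lframe s) :
  hlunit h' ∘ hcomp2 e = s ∘ hlunit h.
Proof.
move: e; have <- : hunit2 (lframe s) = idm _ by rewrite lframe_gsq fmap1.
by move=> e; apply: hlunit_nat.
Qed.

Lemma glob_runit_nat (a b : cob C) (h h' : hmor C a b) (s : globular h h')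
    (e : rframe s = lframe (idm (Harrow (hunit b)))) :
  hrunit h' ∘ hcomp2 e = s ∘ hrunit h.
Proof.
move: e; have <- : hunit2 (rframe s) = idm _ by rewrite rframe_gsq fmap1.
by move=> e; apply: hrunit_nat.
Qed.

Definition hbicat : bicat_on (cob C).
Proof.
exists (hmor C) glob_cat (@hunit C) (@hcomp C) glob_hcomp
  (fun a b c d h k l => glob_iso (lframe_assoc h k l) (rframe_assoc h k l))
  (fun a b h => glob_iso (lframe_lunit h) (rframe_lunit h))
  (fun a b h => glob_iso (lframe_runit h) (rframe_runit h)).
- by move=> *; apply: globular_eq; apply: hcomp21.
- by move=> *; apply: globular_eq; apply: hcomp2M.
- move=> a b c d h h' k k' l l' s t u; apply: globular_eq.
  exact: hassoc_nat.
- by move=> a b h h' s; apply: globular_eq; apply: glob_lunit_nat.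
- by move=> a b h h' s; apply: globular_eq; apply: glob_runit_nat.
- by move=> *; apply: globular_eq; apply: hpentagon.
- by move=> *; apply: globular_eq; apply: htriangle.
Defined.

End Horizontal.

Definition decorated_of (C : double_cat) : decorated_bicat :=
  @Decorated (cob C) (vcat C) (hbicat C).

(* Strict equality of (B^*, B) with (C_0, HC); data on D are transported along it
   to data on C. *)
Definition internalization (D : decorated_bicat) (C : double_cat) : Prop :=
  D = decorated_of C.

Definition induces_opindexing (C : double_cat)
    (Phi : pi2_opindexing (decorated_of C)) : Prop :=
  forall (a b : cob C) (f : hom (vcat C) a b) (s : pi2 (hbicat C) b),
    gsq s ∘ hunit2 f = hunit2 f ∘ gsq (fmap Phi f s).

Definition induces_indexing (C : double_cat)
    (Phi : pi2_indexing (decorated_of C)) : Prop :=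
  forall (a b : cob C) (f : hom (vcat C) a b) (s : pi2 (hbicat C) a),
    hunit2 f ∘ gsq s = gsq (fmap Phi f s) ∘ hunit2 f.

Definition inducing (D : decorated_bicat)
    (Phi : pi2_opindexing D + pi2_indexing D) (C : double_cat) : Prop :=
  exists e : internalization D C,
    match Phi with
    | inl Phi => induces_opindexing (eq_rect D pi2_opindexing Phi _ e)
    | inr Phi => induces_indexing (eq_rect D pi2_indexing Phi _ e)
    end.

Section Length.
Variable C : double_cat.

Inductive generator : forall x y : harrow (hmor C), hom (sqcat C) x y -> Prop :=
| gen_globular (a b : cob C) (h k : hmor C a b) (s : globular h k) :
    generator (gsq s)
| gen_unit (a b : cob C) (f : hom (vcat C) a b) : generator (hunit2 f).

(* Identity squares, associators and unitors are globular, so closure under the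
   two compositions already yields a sub-double category. *)
Inductive in_gamma : forall x y : harrow (hmor C), hom (sqcat C) x y -> Prop :=
| gamma_gen x y (s : hom (sqcat C) x y) : generator s -> in_gamma s
| gamma_vcomp x y z (t : hom (sqcat C) y z) (s : hom (sqcat C) x y) :
    in_gamma t -> in_gamma s -> in_gamma (t ∘ s)
| gamma_hcomp (a b c a' b' c' : cob C) (h : hmor C a b) (k : hmor C b c)
    (h' : hmor C a' b') (k' : hmor C b' c')
    (s : square C h h') (t : square C k k') (e : rframe s = lframe t) :
    in_gamma s -> in_gamma t -> in_gamma (hcomp2 e).

Inductive vertical_composite :
  forall x y : harrow (hmor C), hom (sqcat C) x y -> Prop :=
| vc_gen x y (s : hom (sqcat C) x y) : generator s -> vertical_composite s
| vc_cons x y z (t : hom (sqcat C) y z) (s : hom (sqcat C) x y) :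
    generator t -> vertical_composite s -> vertical_composite (t ∘ s).

Definition length_one : Prop :=
  forall (x y : harrow (hmor C)) (s : hom (sqcat C) x y),
    in_gamma s -> vertical_composite s.

End Length.

(* Main.v *)
From mathcomp Require Import ssreflect ssrfun.
From Stdlib Require Import ProofIrrelevance Program.Equality.
Require Import Defs.

Set Implicit Arguments.
Unset Strict Implicit.
Unset Printing Implicit Defensive.

Local Open Scope cat_scope.

(** A vertical composite of generators that contains a unit square has the form
    [t ∘ U_{f_n} ∘ p_{n-1} ∘ ... ∘ p_1 ∘ U_{f_1} ∘ s], where [t] and [s] are
    globular and each [p_i] is a globular endomorphism of a horizontal
    identity, that is, an element of some [pi2].  An (op)indexing pushes the
    [p_i] through the unit squares, to the top or to the bottom, where they are
    absorbed by [s] or [t]; functoriality of [U] then merges the remaining unit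
    squares.  So every such composite has a normal form: it is globular, or it
    is [t ∘ U_f ∘ s] with [t] and [s] globular ([normal_form_vcomp]).

    Normal forms are also closed under horizontal composition
    ([normal_form_hcomp2]), because both frames of [t ∘ U_f ∘ s] are equal to
    [f].  Two horizontally composable squares of this form therefore have the
    same [f]; by interchange their composite is [U_f ⊙ U_f] between two
    globular squares, and naturality of the left unitor makes [U_f ⊙ U_f] a
    conjugate of [U_f] by globular squares.  If one of the two factors is
    globular, then the other one has an identity frame, so it is globular too.

    Since the generators have normal forms, so does every square of [γC], and
    a normal form is visibly a vertical composite of generators. *)

Section NormalForm.
Variable C : double_cat.

Inductive normal_form : forall x y : harrow (hmor C), hom (sqcat C) x y -> Prop :=
| nf_globular (a b : cob C) (h k : hmor C a b) (s : globular h k) :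
    normal_form (gsq s)
| nf_unit (a b : cob C) (f : hom (vcat C) a b) (h : hmor C a a) (k : hmor C b b)
    (t : globular (hunit b) k) (s : globular h (hunit a)) :
    normal_form (gsq t ∘ hunit2 f ∘ gsq s).

(** The common consequence of inducing an opindexing and of inducing an
    indexing; it leaves open on which side of the unit squares [p] comes out. *)
Definition unit_squares_absorb : Prop :=
  forall (a b c : cob C) (f : hom (vcat C) a b) (g : hom (vcat C) b c)
    (p : globular (hunit b) (hunit b)),
    normal_form (hunit2 g ∘ gsq p ∘ hunit2 f).

Lemma normal_form_vertical_composite (x y : harrow (hmor C))
    (s : hom (sqcat C) x y) :
  normal_form s -> vertical_composite s.
Proof.
case=> [a b h k {}s|a b f h k t {}s]; first exact/vc_gen/gen_globular.
rewrite -mcompA; apply: vc_cons (gen_globular t) _.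
exact: vc_cons (gen_unit f) (vc_gen (gen_globular s)).
Qed.

Lemma normal_form_hunit2 (a b : cob C) (f : hom (vcat C) a b) :
  normal_form (hunit2 f).
Proof.
have := nf_unit f (glob_id (hunit b)) (glob_id (hunit a)).
by rewrite mcomp1m mcompm1.
Qed.

Lemma normal_form_generator (x y : harrow (hmor C)) (s : hom (sqcat C) x y) :
  generator s -> normal_form s.
Proof. by case=> *; [apply: nf_globular | apply: normal_form_hunit2]. Qed.

Lemma normal_form_glob_l (a b : cob C) (h k : hmor C a b) (x : harrow (hmor C))
    (t : globular h k) (s : hom (sqcat C) x (Harrow h)) :
  normal_form s -> normal_form (gsq t ∘ s).
Proof.
move=> ns; dependent destruction ns.
  exact: (nf_globular (glob_vcomp _ _)).
by rewrite !mcompA; apply: nf_unit (glob_vcomp t _) _.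
Qed.

Lemma normal_form_glob_r (a b : cob C) (h k : hmor C a b) (y : harrow (hmor C))
    (t : hom (sqcat C) (Harrow k) y) (s : globular h k) :
  normal_form t -> normal_form (t ∘ gsq s).
Proof.
move=> nt; dependent destruction nt.
  exact: (nf_globular (glob_vcomp _ _)).
by rewrite -mcompA; apply: nf_unit _ (glob_vcomp _ s).
Qed.

Lemma normal_form_vcomp (absorb : unit_squares_absorb) (x y z : harrow (hmor C))
    (t : hom (sqcat C) y z) (s : hom (sqcat C) x y) :
  normal_form t -> normal_form s -> normal_form (t ∘ s).
Proof.
move=> nt; case: nt s => [a b h k {}t|b c g h k t' {}t] s ns.
  exact: normal_form_glob_l.
rewrite -!mcompA; apply: normal_form_glob_l.
dependent destruction ns.
  rewrite mcompA.
  exact/normal_form_glob_r/normal_form_glob_r/normal_form_hunit2.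
rewrite !mcompA; apply: normal_form_glob_r.
(* The two globular squares left between the unit squares form one element of
   [pi2]. *)
rewrite -(mcompA (hunit2 g)).
exact: absorb f g (glob_vcomp _ _).
Qed.

Lemma hcomp2_irr (a b c a' b' c' : cob C) (h : hmor C a b) (k : hmor C b c)
    (h' : hmor C a' b') (k' : hmor C b' c')
    (s : square C h h') (t : square C k k') (e e' : rframe s = lframe t) :
  hcomp2 e = hcomp2 e'.
Proof. by rewrite (proof_irrelevance _ e e'). Qed.

Section UnitForm.
Variables (a b : cob C) (f : hom (vcat C) a b) (h : hmor C a a) (k : hmor C b b).
Variables (t : globular (hunit b) k) (s : globular h (hunit a)).

Lemma lframe_unit_form : lframe (gsq t ∘ hunit2 f ∘ gsq s) = f.
Proof. by rewrite !fmapM lframe_unit !lframe_gsq /= mcompm1 mcomp1m. Qed.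

Lemma rframe_unit_form : rframe (gsq t ∘ hunit2 f ∘ gsq s) = f.
Proof. by rewrite !fmapM rframe_unit !rframe_gsq /= mcompm1 mcomp1m. Qed.

End UnitForm.

(** A normal form between parallel horizontal morphisms with one identity frame
    is globular, since its two frames are the same vertical morphism.  The
    frames are compared with [idm a] and [idm b] because they are equal only
    up to the identification of [a] with [b]. *)
Lemma normal_form_frame_id (a b : cob C) (h k : hmor C a b) (s : square C h k) :
  normal_form s -> lframe s = idm a <-> rframe s = idm b.
Proof.
move=> ns; dependent destruction ns; first by rewrite lframe_gsq rframe_gsq.
by rewrite lframe_unit_form rframe_unit_form.
Qed.

(** Naturality of the left unitor at [U_f], whose left frame is [f]. *)
Lemma hcomp2_hunit2 (a b : cob C) (f : hom (vcat C) a b)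
    (e : rframe (hunit2 f) = lframe (hunit2 f)) :
  hcomp2 e = isoV (hlunit (hunit b)) ∘ hunit2 f ∘ hlunit (hunit a).
Proof.
(* The left factor in [hlunit_nat] is [U] of [lframe (hunit2 f)], which is only
   propositionally [f]; hence the generalization over [g]. *)
suff gen (g : hom (vcat C) a b) (fg : lframe (hunit2 f) = g)
    (eg : rframe (hunit2 g) = lframe (hunit2 f)) :
    hcomp2 eg = isoV (hlunit (hunit b)) ∘ hunit2 f ∘ hlunit (hunit a).
  exact: gen (lframe_unit f) e.
move: fg eg => <- eg.
by rewrite -mcompA -(hlunit_nat eg) mcompA isoVm mcomp1m.
Qed.

Lemma normal_form_hcomp2_globular (a b c : cob C) (h h' : hmor C a b)
    (k k' : hmor C b c) (s : square C h h') (t : square C k k')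
    (e : rframe s = lframe t) :
  lframe s = idm a -> rframe s = idm b -> rframe t = idm c ->
  normal_form (hcomp2 e).
Proof.
move=> ls rs rt; have lt : lframe t = idm b by rewrite -e.
rewrite (hcomp2_irr e (glob_frames (Globular ls rs) (Globular lt rt))).
exact: (nf_globular (glob_hcomp (Globular ls rs) (Globular lt rt))).
Qed.

(** The middle frame identifies [f] with [g]; then interchange splits the
    composite into three layers, and only the layer [U_f ⊙ U_f] is not
    globular. *)
Lemma normal_form_hcomp2_unit (a b : cob C) (f g : hom (vcat C) a b)
    (h h' : hmor C a a) (k k' : hmor C b b)
    (t : globular (hunit b) k) (s : globular h (hunit a))
    (t' : globular (hunit b) k') (s' : globular h' (hunit a))
    (e : rframe (gsq t ∘ hunit2 f ∘ gsq s)
         = lframe (gsq t' ∘ hunit2 g ∘ gsq s')) :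
  normal_form (hcomp2 e).
Proof.
have fg : f = g by rewrite -(rframe_unit_form f t s) e lframe_unit_form.
subst g.
have ef : rframe (hunit2 f) = lframe (hunit2 f).
  by rewrite lframe_unit rframe_unit.
have etf : rframe (gsq t ∘ hunit2 f) = lframe (gsq t' ∘ hunit2 f).
  by rewrite !fmapM ef lframe_gsq rframe_gsq.
rewrite (hcomp2M etf (glob_frames s s') e) (hcomp2M (glob_frames t t') ef etf).
apply: (normal_form_glob_r (glob_hcomp s s')).
apply: (normal_form_glob_l (glob_hcomp t t')).
rewrite hcomp2_hunit2 -mcompA.
apply: (normal_form_glob_l (isoV (glob_iso (lframe_lunit _) (rframe_lunit _)))).
apply: (normal_form_glob_r (isom (glob_iso (lframe_lunit _) (rframe_lunit _)))).
exact: normal_form_hunit2.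
Qed.

Lemma normal_form_hcomp2 (a b c a' b' c' : cob C)
    (h : hmor C a b) (k : hmor C b c) (h' : hmor C a' b') (k' : hmor C b' c')
    (s : square C h h') (t : square C k k') (e : rframe s = lframe t) :
  normal_form s -> normal_form t -> normal_form (hcomp2 e).
Proof.
move=> ns nt; move: (ns) (nt).
dependent destruction ns => ns'; dependent destruction nt => nt'.
- by apply: normal_form_hcomp2_globular; rewrite ?lframe_gsq ?rframe_gsq.
- apply: normal_form_hcomp2_globular; rewrite ?lframe_gsq ?rframe_gsq //.
  by apply/(normal_form_frame_id nt'); rewrite -e rframe_gsq.
- have rs := etrans e (lframe_gsq _).
  apply: normal_form_hcomp2_globular; rewrite ?rframe_gsq //.
  exact/(normal_form_frame_id ns').
- exact: normal_form_hcomp2_unit.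
Qed.

Lemma length_one_of_absorb : unit_squares_absorb -> length_one C.
Proof.
move=> absorb x y s gs; apply: normal_form_vertical_composite.
elim: gs => *; first exact: normal_form_generator.
- exact: normal_form_vcomp.
- exact: normal_form_hcomp2.
Qed.

Lemma opindexing_absorb (Phi : pi2_opindexing (decorated_of C)) :
  induces_opindexing Phi -> unit_squares_absorb.
Proof.
move=> ind a b c f g p; rewrite -mcompA ind mcompA -fmapM.
exact/normal_form_glob_r/normal_form_hunit2.
Qed.

Lemma indexing_absorb (Phi : pi2_indexing (decorated_of C)) :
  induces_indexing Phi -> unit_squares_absorb.
Proof.
move=> ind a b c f g p; rewrite ind -mcompA -fmapM.
exact/normal_form_glob_l/normal_form_hunit2.
Qed.

End NormalForm.

Theorem corollary3p5 (D : decorated_bicat)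
    (Phi : pi2_opindexing D + pi2_indexing D) (C : double_cat) :
  inducing Phi C -> length_one C.
Proof.
case: Phi => Phi [e ind]; apply: length_one_of_absorb.
- exact: opindexing_absorb ind.
- exact: indexing_absorb ind.
Qed.
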